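(* Let $A\in\mathbb R^{m\times n}$ and $\beta\in\mathbb R^n$ be non-zero, and let $C=-A$, with $P$ and $Q'$ non-degenerate. Then $\mathcal N$ does not contain cycles.
   Context: Let $S_1=\{1,\dots,m\}$, $S_2=\{1,\dots,n\}$. For a matrix $M$, $M_i$ is its $i$-th row and $M^j$ its $j$-th column. $P=\{(y,\pi_1)\in\mathbb R^{n+1}: A_iy-\pi_1\le0\ (i\in S_1);\ y_j\ge0\ (j\in S_2);\ \sum_j y_j=1\}$ (of dimension $n$). $Q'=\{(x,\lambda,\pi_2)\in\mathbb R^{m+2}: x_i\ge0\ (i\in S_1);\ x^TC^j+\beta_j\lambda-\pi_2\le0\ (j\in S_2);\ \sum_i x_i=1\}$ (of dimension $m+1$), with $C=-A$. In both polyhedra the inequalities indexed by $i\in S_1$ are numbered $1,\dots,m$ and those indexed by $j\in S_2$ are numbered $m+1,\dots,m+n$. The label $L(v)$ of a point is the set of numbers of inequalities tight at it. $\mathcal N=\{(v,w)\in P\times Q': L(v)\cup L(w)=\{1,\dots,m+n\}\}$. Non-degeneracy: every point in the relative interior of a $d$-dimensional face of $P$ (resp. $Q'$) has exactly $n-d$ (resp. $m+1-d$) tight inequalities. Non-degeneracy of $Q'$ is understood to entail that $\beta$ is not constant. For general $C$ and non-degenerate $P,Q'$, $\mathcal N$ is a disjoint union of connected components lying on the $1$-skeleton of $P\times Q'$: exactly one path (homeomorphic to $\mathbb R$, with an unbounded edge at each end) and finitely many (possibly zero) cycles (homeomorphic to a circle). *)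

(* Defs.v *)
(* MathComp / MathComp-Analysis *)
From HB Require Import structures.
From mathcomp Require Import all_boot all_order all_algebra.
From mathcomp Require Import all_classical all_reals all_analysis.

Set Implicit Arguments.
Unset Strict Implicit.
Unset Printing Implicit Defensive.

Import Order.TTheory GRing.Theory Num.Theory.
Import numFieldNormedType.Exports.

Local Open Scope classical_set_scope.
Local Open Scope ring_scope.

Section ConvexGeometry.
Context {R : realType} {V : normedModType R}.
Implicit Types (S F : set V) (d : nat).

Definition affine_hull S : set V :=
  [set x | exists k (p : 'I_k -> V) (c : 'I_k -> R),
     [/\ forall i, S (p i), \sum_i c i = 1 & x = \sum_i c i *: p i]].

Definition affinely_independent k (p : 'I_k -> V) : Prop :=
  forall c : 'I_k -> R,
    \sum_i c i = 0 -> \sum_i c i *: p i = 0 -> forall i, c i = 0.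

(* The empty set has no dimension in this sense. *)
Definition has_affine_dim S d : Prop :=
  exists p : 'I_d.+1 -> V,
    [/\ forall i, S (p i), affinely_independent p
      & S `<=` affine_hull (range p)].

Definition relative_interior S : set V :=
  [set x | S x /\ \forall y \near x, affine_hull S y -> S y].

(* f = 0 and c = 0 give S itself; for a polyhedron these are all its faces. *)
Definition is_face S F : Prop :=
  exists (f : {scalar V}) (c : R),
    (forall x, S x -> f x <= c) /\ F = [set x | S x /\ f x = c].

(* [tight x] is the set of inequalities tight at x, and N is the dimension
   of S. The number of tight inequalities N - d is stated additively because
   subtraction on nat is truncated. *)
Definition nondegenerate S (I : finType) (tight : V -> {set I}) (N : nat) :
    Prop :=
  forall F d x, is_face S F -> has_affine_dim F d ->
    relative_interior F x -> (#|tight x| + d)%N = N.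

End ConvexGeometry.

Section Cycles.
Context {R : realType}.

Definition homeomorphic (T U : topologicalType) (A : set T) (B : set U) :
    Prop :=
  exists (f : T -> U) (g : U -> T),
    [/\ {within A, continuous f}, {within B, continuous g},
        (forall x, A x -> B (f x) /\ g (f x) = x)
      & (forall y, B y -> A (g y) /\ f (g y) = y)].

Definition circle : set (R * R) := [set z | z.1 ^+ 2 + z.2 ^+ 2 = 1].

Definition is_cycle_of (T : topologicalType) (X K : set T) : Prop :=
  (exists2 z, X z & K = connected_component X z) /\ homeomorphic K circle.

End Cycles.

Section Polyhedra.
Context {R : realType} {m n : nat}.
Implicit Types (A C : 'M[R]_(m, n)) (beta : 'rV[R]_n).

(* Points are (y, pi1). *)
Definition polyP A : set ('cV[R]_n * R) :=
  [set v : 'cV[R]_n * R |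
    [/\ forall i, (A *m v.1) i 0 - v.2 <= 0,
        forall j, 0 <= v.1 j 0
      & \sum_j v.1 j 0 = 1]].

(* Points are (x, lambda, pi2), that is ((x, lambda), pi2). *)
Definition polyQ C beta : set ('cV[R]_m * R * R) :=
  [set w : 'cV[R]_m * R * R |
    [/\ forall i, 0 <= w.1.1 i 0,
        forall j, (w.1.1^T *m C) 0 j + beta 0 j * w.1.2 - w.2 <= 0
      & \sum_i w.1.1 i 0 = 1]].

(* Labels: 'I_m is embedded first in 'I_(m + n), then 'I_n. *)
Definition labelP A (v : 'cV[R]_n * R) : {set 'I_(m + n)} :=
  [set k : 'I_(m + n) |
    match fintype.split k with
    | inl i => (A *m v.1) i 0 - v.2 == 0
    | inr j => v.1 j 0 == 0
    end]%SET.

Definition labelQ C beta (w : 'cV[R]_m * R * R) : {set 'I_(m + n)} :=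
  [set k : 'I_(m + n) |
    match fintype.split k with
    | inl i => w.1.1 i 0 == 0
    | inr j => (w.1.1^T *m C) 0 j + beta 0 j * w.1.2 - w.2 == 0
    end]%SET.

Definition nondegenerateP A : Prop :=
  nondegenerate (polyP A) (labelP A) n.

(* If beta is constant c then polyQ C beta is invariant under translation
   along (0, 1, c); this case is excluded by convention. *)
Definition nondegenerateQ C beta : Prop :=
  nondegenerate (polyQ C beta) (labelQ C beta) m.+1 /\
  forall c, beta <> const_mx c.

Definition fully_labeled A C beta :
    set (('cV[R]_n * R) * ('cV[R]_m * R * R)) :=
  [set z | [/\ polyP A z.1, polyQ C beta z.2
             & labelP A z.1 :|: labelQ C beta z.2 = [set: 'I_(m + n)]%SET]].

End Polyhedra.

(* Main.v *)
(* Since C = - A, complementary slackness sums to pi1 + pi2 = lambda (beta . y),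
   which is affine once lambda is fixed: the slices of N at constant lambda are
   convex. On a circle a continuous function with connected fibres is constant:
   an intermediate value is attained on both arcs between two points with
   different values, and a connected fibre would have to cross the chord joining
   these points. So lambda is constant on a cycle, which is then convex, and
   every affine form is constant on it for the same reason: it is a single
   point. *)
Require Import Defs.
From mathcomp Require Import all_boot all_order all_algebra.
From mathcomp Require Import all_classical all_reals all_analysis.
From mathcomp Require Import ring lra.

Import Order.TTheory GRing.Theory Num.Theory.
Import numFieldNormedType.Exports.

Local Open Scope classical_set_scope.
Local Open Scope ring_scope.

(** * Angles on the circle and level sets of continuous functions on it *)

Section Circle.
Context {R : realType}.
Implicit Types (a b t : R) (z : R * R).

Definition circle_point t : R * R := (cos t, sin t).

Lemma circle_pointP t : circle (circle_point t).
Proof. by rewrite /circle /= cos2Dsin2. Qed.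

Lemma continuous_circle_point : continuous circle_point.
Proof.
by move=> t; exact: (cvg_pair (@continuous_cos R t) (@continuous_sin R t)).
Qed.

Lemma circle_point_angle0 z :
  circle z -> exists t, [/\ 0 <= t, t < pi *+ 2 & circle_point t = z].
Proof.
case: z => x y; rewrite /circle /= => xy1.
have x1 : -1 <= x <= 1.
  by apply/andP; split; nra.
have /andP[ac0 acpi] : 0 <= acos x <= pi by rewrite acos_ge0 ?acos_lepi.
have cosac : cos (acos x) = x by apply: acosK; rewrite in_itv.
have sqy : Num.sqrt (1 - x ^+ 2) = `|y|.
  by rewrite -xy1 addrAC subrr add0r sqrtr_sqr.
have [y0|y0] := leP 0 y.
  exists (acos x); split => //; first by rewrite mulr2n; have := pi_gt0 R; lra.
  by rewrite /circle_point cosac sin_acos// sqy ger0_norm.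
(* Below the axis [x] = 1 is impossible, so [acos x] > 0, which keeps the angle 2 pi - [acos x]
   strictly below 2 pi. *)
have x_lt1 : -1 <= x < 1.
  case/andP: x1 => -> x1 /=; rewrite lt_neqAle x1 andbT.
  by apply: contraTneq y0 => x1E; move: xy1; rewrite x1E; nra.
have ac_gt0 := acos_gt0 x_lt1.
exists (- acos x + pi *+ 2); split.
- by rewrite mulr2n; have := pi_gt0 R; lra.
- by rewrite gtrDr oppr_lt0.
- by rewrite /circle_point cosD2pi sinD2pi cosN sinN cosac sin_acos// sqy
    ltr0_norm// opprK.
Qed.

(** Rotating by -[a] reduces this to angles counted from 0; [w] is the rotated point. *)
Lemma circle_point_angle a z :
  circle z -> exists t, [/\ a <= t, t < a + pi *+ 2 & circle_point t = z].
Proof.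
move=> cz.
pose w : R * R :=
  (z.1 * cos a + z.2 * sin a, z.2 * cos a - z.1 * sin a).
have cw : circle w.
  have := cos2Dsin2 a; move: cz; rewrite /circle /w /= => cz ca.
  rewrite -[RHS](mulr1 1) -{1}cz -ca; ring.
have [t [t0 t2 [cwt swt]]] := circle_point_angle0 _ cw.
have ca := cos2Dsin2 a.
exists (a + t); split; rewrite ?lerDl ?ltrD2l// /circle_point cosD sinD cwt swt.
case: z {cz w cw cwt swt} => x y /=; congr pair.
  by rewrite -[RHS]mulr1 -ca; ring.
by rewrite -[RHS]mulr1 -ca; ring.
Qed.

(* The affine form vanishing on the chord joining the points of angles a and b
   takes, at the point of angle t, a product of two sines as its value. *)
Lemma chord_formE a b t :
  cos t * cos ((a + b) / 2) + sin t * sin ((a + b) / 2) - cos ((b - a) / 2)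
  = 2 * (sin ((t - a) / 2) * sin ((b - t) / 2)).
Proof.
rewrite -cosB.
have -> : t - (a + b) / 2 = (t - a) / 2 - (b - t) / 2 by field.
have -> : (b - a) / 2 = (t - a) / 2 + (b - t) / 2 by field.
by rewrite cosB cosD; ring.
Qed.

(** The negative product says that [c] lies strictly between the values at the angles [a] and [b].
    Each of the two arcs then carries a point of level [c], and the chord form has opposite signs at
    them. Connectedness would give a zero of this form on the level set, but on the circle it
    vanishes only at the ends of the chord, where the value is not [c]. *)
Lemma connected_fiber_circle_arc (T : topologicalType) (K : set T)
    (f : T -> R * R) (g : R * R -> T) (l : T -> R) a b c :
  {within K, continuous f} -> {within circle, continuous g} ->
  (forall x, K x -> circle (f x) /\ g (f x) = x) ->
  (forall z, circle z -> K (g z) /\ f (g z) = z) ->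
  continuous l ->
  a < b < a + pi *+ 2 ->
  (l (g (circle_point a)) - c) * (l (g (circle_point b)) - c) < 0 ->
  ~ connected (K `&` l @^-1` [set c]).
Proof.
move=> cf cg fK gK cl /andP[ab ba] lab conn.
pose p := l \o (g \o circle_point).
(* [g] is continuous only relative to [circle]; as [circle_point] never leaves it, the composite is
   continuous on the whole line. *)
have cp : continuous p.
  move=> t; apply: continuous_comp; last exact: cl.
  apply: (cvg_comp _ _ _ ((subspace_continuousP _ _).1 cg _ (circle_pointP t))).
  move=> U /= wU; have := continuous_circle_point _ _ wU.
  rewrite !nbhs_simpl /=; apply: filterS => s; apply.
  exact: (circle_pointP s).
have pper t : p (t + pi *+ 2) = p t.
  by rewrite /p /= /circle_point cosD2pi sinD2pi.
have {}lab : (p a - c) * (p b - c) < 0 := lab.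
(* The strict sign condition keeps the solution away from both endpoints. *)
have ivt u v : u <= v -> (p u - c) * (p v - c) < 0 ->
    exists2 t, u < t < v & p t = c.
  move=> uv puv.
  have [|t] := IVT uv (continuous_subspaceT cp) (v := c).
    by rewrite ge_min le_max; apply/andP; split; apply: contraTT puv;
      rewrite negb_or -!ltNge -leNgt => /andP[? ?]; nra.
  rewrite in_itv/= => /andP[ut tv] ptc; exists t => //.
  rewrite !lt_neqAle ut tv !andbT; apply/andP; split; apply/eqP => E;
    by move: puv; rewrite ?E ?ptc -?E ?ptc subrr ?mul0r ?mulr0 ltxx.
have [u /andP[au ub] pu] := ivt _ _ (ltW ab) lab.
have [v /andP[bv va] pv] : exists2 t, b < t < a + pi *+ 2 & p t = c.
  by apply: ivt; rewrite ?ltW// pper mulrC.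
pose h z := z.1 * cos ((a + b) / 2) + z.2 * sin ((a + b) / 2)
            - cos ((b - a) / 2).
have ch : continuous h.
  move=> z; apply: cvgB; last exact: cvg_cst.
  apply: cvgD; apply: cvgM;
    [exact: cvg_fst|exact: cvg_cst|exact: cvg_snd|exact: cvg_cst].
set F := K `&` _ in conn.
have : connected ((h \o f) @` F).
  apply: connected_continuous_connected => //.
  apply: within_continuous_comp; first by move=> ? _; exact: ch.
  by apply: continuous_subspaceW cf => x [].
have inF t : p t = c ->
    ((h \o f) @` F) (2 * (sin ((t - a) / 2) * sin ((b - t) / 2))).
  move=> ptc; have [Kg fg] := gK _ (circle_pointP t).
  by exists (g (circle_point t)) => //=; rewrite fg -chord_formE.
have pi0 := pi_gt0 R.
rewrite mulr2n in ba va.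
have sin_neg t : - pi < t < 0 -> sin t < 0.
  by move=> tpi; rewrite -oppr_gt0 -sinN sin_gt0_pi//; lra.
(* The half-angle sines have opposite signs at [v] and are both positive at [u], so 0 is a value of
   the chord form on the level set. *)
move=> /connected_intervalP /(_ _ _ (inF _ pv) (inF _ pu) 0)[].
  apply/andP; split; apply/ltW.
    by rewrite pmulr_rlt0// pmulr_rlt0 ?sin_neg ?sin_gt0_pi//; lra.
  by rewrite !mulr_gt0// sin_gt0_pi//; lra.
move=> x [Kx lx] hfx.
have [cfx gfx] := fK _ Kx.
have [t [at_ ta tE]] := circle_point_angle a _ cfx.
have ptc : p t = c by rewrite /p /= tE gfx.
move: hfx; rewrite /= -tE /h chord_formE => /eqP.
rewrite mulr2n in ta.
have ta' : a < t.
  rewrite lt_neqAle at_ andbT; apply/eqP => E.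
  by move: lab; rewrite E ptc subrr mul0r ltxx.
(* With [t] in ([a], [a] + 2 pi) the first sine is positive and the second vanishes only at [t] =
   [b], where [p] is not [c]. *)
rewrite !mulf_eq0 pnatr_eq0/= => /orP[|].
  by rewrite gt_eqF// sin_gt0_pi//; lra.
have [tb|tb|tb] := ltgtP t b.
- by rewrite gt_eqF// sin_gt0_pi//; lra.
- by rewrite lt_eqF// sin_neg//; lra.
- by move: lab; rewrite -tb ptc subrr mulr0 ltxx.
Qed.

(** If two values differ, their midpoint is a level strictly between them: the product of the two
    differences is minus a nonzero square. *)
Lemma connected_fibers_circle_const (T : topologicalType) (K : set T)
    (l : T -> R) :
  homeomorphic K (@circle R) -> continuous l ->
  (forall c, connected (K `&` l @^-1` [set c])) ->
  forall x y, K x -> K y -> l x = l y.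
Proof.
move=> [f [g [cf cg fK gK]]] cl conn x y Kx Ky.
apply/eqP/negP => /negP lxy.
have [cfx gfx] := fK _ Kx; have [cfy gfy] := fK _ Ky.
have [a [_ _ aE]] := circle_point_angle 0 _ cfx.
have [b [ab ba bE]] := circle_point_angle a _ cfy.
have lab : (l (g (circle_point a)) - (l x + l y) / 2) *
           (l (g (circle_point b)) - (l x + l y) / 2) < 0.
  rewrite aE bE gfx gfy.
  have -> : (l x - (l x + l y) / 2) * (l y - (l x + l y) / 2) =
    - ((l x - l y) / 2) ^+ 2 by field.
  by rewrite oppr_lt0 exprn_even_gt0//= mulf_neq0// subr_eq0.
apply: (connected_fiber_circle_arc _ _ _ _ _ _ _ _ cf cg fK gK cl _ lab)
  (conn _).
rewrite ba andbT lt_neqAle ab andbT; apply: contraNneq lxy => E.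
by rewrite -gfx -gfy -aE -bE E.
Qed.

End Circle.

(** * Affine functions on a cycle with convex slices *)

Section Convexity.
Context {R : realType} {V : normedModType R}.

(** The set is the union of its segments issued from one common point. *)
Lemma convex_connected (S : set V) :
  (forall x y (t : R), S x -> S y -> 0 <= t <= 1 -> S (x + t *: (y - x))) ->
  connected S.
Proof.
move=> cS; have [->|/set0P[x Sx]] := eqVneq S set0; first exact: connected0.
pose seg y := (fun t : R => x + t *: (y - x)) @` `[0, 1].
have segl y : seg y x.
  by exists 0; rewrite ?scale0r ?addr0//= in_itv/= lexx ler01.
have segr y : seg y y.
  by exists 1; rewrite ?scale1r ?subrKC//= in_itv/= lexx ler01.
have -> : S = \bigcup_(y in S) seg y.
  apply/seteqP; split=> [y Sy|z [y Sy [t]]]; first by exists y.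
  by rewrite /= in_itv/= => t01 <-; exact: cS.
apply: bigcup_connected; first by exists x => y _; exact: segl.
move=> y _; apply: connected_continuous_connected.
  exact: segment_connected.
apply: continuous_subspaceT => t.
by apply: cvgD; [exact: cvg_cst|apply: cvgZ; [exact: cvg_id|exact: cvg_cst]].
Qed.

Definition continuous_affine (l : V -> R) : Prop :=
  continuous l /\
  forall x y (t : R), l (x + t *: (y - x)) = l x + t * (l y - l x).

(** The circle argument is applied twice: to [lam], whose level sets in [K] are convex, and then to
    [l], whose level sets are convex once [lam] is constant on [K]. *)
Lemma affine_const_cycle (N K : set V) (lam l : V -> R) :
  is_cycle_of (R := R) N K -> continuous_affine lam -> continuous_affine l ->
  (forall x y (t : R), N x -> N y -> lam x = lam y -> 0 <= t <= 1 ->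
    N (x + t *: (y - x))) ->
  forall x y, K x -> K y -> l x = l y.
Proof.
move=> [[z0 Nz0 KE] homK] lam_aff l_aff sliceN.
have KN : K `<=` N by rewrite KE; exact: connected_component_sub.
have affE (f : V -> R) x y t : continuous_affine f -> f x = f y ->
    f (x + t *: (y - x)) = f x.
  by move=> [_ ->] ->; rewrite subrr mulr0 addr0.
have sliceK x y (t : R) : K x -> K y -> lam x = lam y -> 0 <= t <= 1 ->
    K (x + t *: (y - x)).
  move=> Kx Ky xy t01.
  (* The whole slice of [N] through [x] is convex, hence connected, so the component [K] of [x]
     contains it. *)
  pose S := N `&` lam @^-1` [set lam x].
  have cS : connected S.
    apply: convex_connected => u v s [Nu lu] [Nv lv] s01.
    have uv : lam u = lam v by rewrite lu lv.
    by split; [exact: sliceN|rewrite /= affE].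
  have Sx : S x by split=> //; exact: KN.
  have -> : K = connected_component N x.
    by rewrite KE; apply: same_connected_component; rewrite -KE.
  apply: (connected_component_max Sx _ cS); first by move=> u [].
  by split; [apply: sliceN => //; exact: KN|rewrite /= affE].
have fiberK f : continuous_affine f ->
    (forall x y, K x -> K y -> f x = f y -> lam x = lam y) ->
    forall x y, K x -> K y -> f x = f y.
  move=> f_aff flam; have [cf _] := f_aff.
  apply: connected_fibers_circle_const homK cf _ => c.
  apply: convex_connected => x y t [Kx fx] [Ky fy] t01.
  have fxy : f x = f y by rewrite fx fy.
  by split; [apply: sliceK => //; exact: flam|rewrite /= affE].
by apply: (fiberK l) => // x y Kx Ky _; exact: (fiberK lam).
Qed.

End Convexity.

(** * Complementary slackness and convexity of the slices *)

Section ZeroSum.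
Context {R : realType} {m n : nat}.
Variables (A : 'M[R]_(m, n)) (beta : 'rV[R]_n).
Implicit Types (v : 'cV[R]_n * R) (w : 'cV[R]_m * R * R) (t : R).

Definition slackP v i : R := v.2 - (A *m v.1) i 0.

Definition slackQ w j : R :=
  w.2 - ((w.1.1^T *m - A) 0 j + beta 0 j * w.1.2).

(** The bilinear terms in [A] and [- A] cancel, and the normalisations of x and y leave [v.2] and
    [w.2] with coefficient one. *)
Lemma sum_slack v w :
  Defs.polyP A v -> polyQ (- A) beta w ->
  \sum_i w.1.1 i 0 * slackP v i + \sum_j v.1 j 0 * slackQ w j =
  v.2 + w.2 - w.1.2 * \sum_j beta 0 j * v.1 j 0.
Proof.
move=> [_ _ y1] [_ _ x1].
have xAy : \sum_i w.1.1 i 0 * (A *m v.1) i 0 =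
           \sum_j v.1 j 0 * (w.1.1^T *m A) 0 j.
  transitivity ((w.1.1^T *m (A *m v.1)) 0 0).
    by rewrite mxE; apply: eq_bigr => i _; rewrite [in RHS]mxE.
  by rewrite mulmxA mxE; apply: eq_bigr => j _; rewrite mulrC.
have xNA j : (w.1.1^T *m - A) 0 j = - (w.1.1^T *m A) 0 j.
  by rewrite mulmxN mxE.
under eq_bigr do rewrite mulrBr.
rewrite big_split /= sumrN -mulr_suml x1 mul1r xAy.
under [X in _ + X]eq_bigr => j _.
  rewrite (_ : _ * _ = v.1 j 0 * w.2 + v.1 j 0 * (w.1.1^T *m A) 0 j
    - w.1.2 * (beta 0 j * v.1 j 0)); last first.
    by rewrite /slackQ xNA; ring.
  over.
by rewrite big_split big_split /= sumrN -mulr_suml y1 -mulr_sumr; ring.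
Qed.

(** All terms of the slackness sum are nonnegative on the two polyhedra, so the sum vanishes exactly
    when each product does; a product vanishes exactly when its label is present on one of the two
    sides. *)
Lemma fully_labeled_gapE z :
  fully_labeled A (- A) beta z <->
  [/\ Defs.polyP A z.1, polyQ (- A) beta z.2
    & z.1.2 + z.2.2 = z.2.1.2 * \sum_j beta 0 j * z.1.1 j 0].
Proof.
case: z => v w; rewrite /fully_labeled /=.
have iff3 (P Q X Y : Prop) : (P -> Q -> (X <-> Y)) ->
    [/\ P, Q & X] <-> [/\ P, Q & Y].
  by move=> XY; split=> -[p q r]; split => //; apply/(XY p q).
apply: iff3 => Pv Qw; have sE := sum_slack _ _ Pv Qw.
have [P1 P2 _] := Pv; have [Q1 Q2 _] := Qw.
have p_ge0 i : 0 <= w.1.1 i 0 * slackP v i.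
  by rewrite mulr_ge0// subr_ge0 -subr_le0.
have q_ge0 j : 0 <= v.1 j 0 * slackQ w j.
  by rewrite mulr_ge0// subr_ge0 -subr_le0.
have slP i : (slackP v i == 0) = ((A *m v.1) i 0 - v.2 == 0).
  by rewrite -oppr_eq0 opprB.
have slQ j : (slackQ w j == 0) =
    ((w.1.1^T *m - A) 0 j + beta 0 j * w.1.2 - w.2 == 0).
  by rewrite -oppr_eq0 opprB.
split=> [L|gap].
  apply/eqP; rewrite -subr_eq0 -sE.
  rewrite !big1 ?addr0// => [j _|i _]; apply/eqP; rewrite mulf_eq0.
    have := finset.in_setT (rshift m j); rewrite -L !inE.
    (* [rshift m j] is [unsplit (inr j)] by conversion, which lets [unsplitK] resolve the match in
       the labels. *)
    by rewrite -[rshift m j]/(unsplit (inr j)) unsplitK slQ.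
  have := finset.in_setT (lshift n i); rewrite -L !inE.
  by rewrite -[lshift n i]/(unsplit (inl i)) unsplitK slP orbC.
move: sE; rewrite gap subrr => /eqP.
rewrite paddr_eq0 ?sumr_ge0// !psumr_eq0// => /andP[/allP p0 /allP q0].
apply/setP => k; rewrite !inE -[k]splitK.
case: (fintype.split k) => [i|j]; rewrite unsplitK.
  by have := p0 i (mem_index_enum i); rewrite mulf_eq0 slP orbC.
by have := q0 j (mem_index_enum j); rewrite mulf_eq0 slQ.
Qed.

Lemma polyP_convex v v' t :
  Defs.polyP A v -> Defs.polyP A v' -> 0 <= t <= 1 ->
  Defs.polyP A (v + t *: (v' - v)).
Proof.
move=> [v1 v2 v3] [u1 u2 u3] /andP[t0 t1].
split => [i|j|].
(* [R] is scaled here as a module over itself; reading [*:] as a product makes the goal polynomial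
   for [nra]. *)
- rewrite /= mulmxDr -scalemxAr mulmxBr !mxE -[t *: _]/(t * _).
  by move: (v1 i) (u1 i); rewrite !mxE; nra.
- by rewrite !mxE; move: (v2 j) (u2 j); nra.
- under eq_bigr do rewrite !mxE.
  by rewrite big_split /= -mulr_sumr big_split /= sumrN v3 u3; ring.
Qed.

Lemma polyQ_convex w w' t :
  polyQ (- A) beta w -> polyQ (- A) beta w' -> 0 <= t <= 1 ->
  polyQ (- A) beta (w + t *: (w' - w)).
Proof.
move=> [v1 v2 v3] [u1 u2 u3] /andP[t0 t1].
split => [i|j|].
- by rewrite !mxE; move: (v1 i) (u1 i); nra.
- rewrite /= linearD linearZ linearB/= mulmxDl -scalemxAl mulmxBl.
  rewrite ![(_ + _ : 'rV[R]_n) _ _]mxE ![(_ *: _ : 'rV[R]_n) _ _]mxE.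
  rewrite ![(_ + _ : 'rV[R]_n) _ _]mxE ![(- _ : 'rV[R]_n) _ _]mxE.
  rewrite -![t *: _]/(t * _).
  by move: (v2 j) (u2 j); nra.
- under eq_bigr do rewrite !mxE.
  by rewrite big_split /= -mulr_sumr big_split /= sumrN v3 u3; ring.
Qed.

(** With lambda equal at both ends, the gap equation is affine along the segment. *)
Lemma fully_labeled_convex z z' t :
  fully_labeled A (- A) beta z -> fully_labeled A (- A) beta z' ->
  z.2.1.2 = z'.2.1.2 -> 0 <= t <= 1 ->
  fully_labeled A (- A) beta (z + t *: (z' - z)).
Proof.
move=> /fully_labeled_gapE[Pz Qz gz] /fully_labeled_gapE[Pz' Qz' gz'] zz' t01.
apply/fully_labeled_gapE; split; [exact: polyP_convex|exact: polyQ_convex|].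
rewrite /= -zz' subrr scaler0 addr0 -![t *: _]/(t * _).
have -> : \sum_j beta 0 j * (z.1.1 + t *: (z'.1.1 - z.1.1)) j 0 =
    \sum_j beta 0 j * z.1.1 j 0 + t * (\sum_j beta 0 j * z'.1.1 j 0
    - \sum_j beta 0 j * z.1.1 j 0).
  rewrite -sumrB mulr_sumr -big_split; apply: eq_bigr => j _.
  by rewrite !mxE /=; ring.
transitivity (z.1.2 + z.2.2 + t * (z'.1.2 + z'.2.2 - (z.1.2 + z.2.2))).
  by ring.
by rewrite gz gz' zz'; ring.
Qed.

End ZeroSum.

(** * Collapse of a cycle to a point *)

Theorem proposition16 (R : realType) (m n : nat)
    (A C : 'M[R]_(m, n)) (beta : 'rV[R]_n)
    (beta_neq0 : beta != 0)
    (CA : C = - A)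
    (ndP : nondegenerateP A)
    (ndQ : nondegenerateQ C beta) :
  ~ exists K, is_cycle_of (R := R) (fully_labeled A C beta) K.
Proof.
rewrite CA => -[K cycK].
pose lam (z : ('cV[R]_n * R) * ('cV[R]_m * R * R)) := z.2.1.2.
have affine_lam : continuous_affine lam.
  split=> [z|//].
  exact: (cvg_comp _ _ (cvg_comp _ _ cvg_snd cvg_fst) cvg_snd).
have affine_const l : continuous_affine l ->
    forall x y, K x -> K y -> l x = l y.
  move=> l_aff; apply: affine_const_cycle cycK affine_lam l_aff _.
  exact: fully_labeled_convex.
(* Every coordinate is a continuous affine function, hence constant on [K]. *)
have K1 x y : K x -> K y -> x = y.
  case: x y => [[y1 p1] [[x1 l1] q1]] [[y2 p2] [[x2 l2] q2]] Kx Ky.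
  congr (_, _, (_, _, _)).
  - apply/matrixP => i j; rewrite ord1.
    apply: (affine_const (fun z => z.1.1 i 0) _ _ _ Kx Ky).
    split=> [z|u v t]; last by rewrite /= !mxE.
    apply: (continuous_comp (f := fun z => z.1.1)
      (g := fun M : 'cV[R]_n => M i 0)); last exact: coord_continuous.
    exact: (cvg_comp _ _ cvg_fst cvg_fst).
  - apply: (affine_const (fun z => z.1.2) _ _ _ Kx Ky).
    by split=> [z|//]; exact: (cvg_comp _ _ cvg_fst cvg_snd).
  - apply/matrixP => i j; rewrite ord1.
    apply: (affine_const (fun z => z.2.1.1 i 0) _ _ _ Kx Ky).
    split=> [z|u v t]; last by rewrite /= !mxE.
    apply: (continuous_comp (f := fun z => z.2.1.1)
      (g := fun M : 'cV[R]_m => M i 0)); last exact: coord_continuous.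
    exact: (cvg_comp _ _ (cvg_comp _ _ cvg_snd cvg_fst) cvg_fst).
  - exact: (affine_const lam _ _ _ Kx Ky).
  - apply: (affine_const (fun z => z.2.2) _ _ _ Kx Ky).
    by split=> [z|//]; exact: (cvg_comp _ _ cvg_snd cvg_snd).
have [_ [f [g [_ _ _ gK]]]] := cycK.
have [Kg0 fg0] := gK _ (circle_pointP 0).
have [Kgpi fgpi] := gK _ (circle_pointP pi).
(* The antipodal points of angles 0 and pi would coincide, although their cosines are 1 and -1. *)
have : @circle_point R 0 = circle_point pi.
  by rewrite -fg0 -fgpi (K1 _ _ Kg0 Kgpi).
by move=> -[]; rewrite cos0 cospi => /eqP; rewrite gt_eqF// (lt_trans ltrN10).
Qed.
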